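(* Let $p\in(1,\infty)$, $q\in[1,\infty)$, $s\in\mathbb{Z}_+$, $\alpha\in[0,\frac{s+1}{n}]$ and $\kappa=\{p,q,\alpha+\frac1q-\frac1p,s\}$. Then the spaces $V_\kappa([0,1]^n)$ and $JN_{(p,q,s)_\alpha}([0,1]^n)$ coincide with equivalent norms.
   Context: $\mathbb{Z}_+$ is the set of non-negative integers. Cubes in $\mathbb{R}^n$ have edges parallel to the coordinate axes and finite positive edge length. $\mathcal{P}_s(Q)$ is the set of polynomials of degree not greater than $s$ on $Q$. For $s\in\mathbb{Z}_+$, a cube $Q$ and an integrable $f$, $P_Q^{(s)}(f)$ denotes the unique polynomial of degree not greater than $s$ such that $\int_Q[f(x)-P_Q^{(s)}(f)(x)]x^\gamma\,dx=0$ for all multi-indices $\gamma\in\mathbb{Z}_+^n$ with $|\gamma|\le s$. $JN_{(p,q,s)_\alpha}([0,1]^n)$ is the set of $f\in L^1([0,1]^n)$ with $$\|f\|_{JN_{(p,q,s)_\alpha}([0,1]^n)}:=\sup\left\{\sum_i|Q_i|\left[|Q_i|^{-\alpha}\left(\frac1{|Q_i|}\int_{Q_i}|f-P_{Q_i}^{(s)}(f)|^q\right)^{1/q}\right]^p\right\}^{1/p}<\infty,$$ the supremum being over all collections of pairwise disjoint cubes $\{Q_i\}_i$ in $[0,1]^n$. For $\kappa=\{p,q,\lambda,s\}$ with $p,q\in[1,\infty]$, $\lambda\in\mathbb{R}$, $s\in\mathbb{Z}_+$ (only finite $p,q$ are needed here), $V_\kappa([0,1]^n)$ is the set of $f\in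 L^q([0,1]^n)$ with $$\|f\|_{V_\kappa([0,1]^n)}:=\sup\left\{\sum_i\left[|Q_i|^{-\lambda}\inf_{m\in\mathcal{P}_s(Q_i)}\|f-m\|_{L^q(Q_i)}\right]^p\right\}^{1/p}<\infty,$$ the supremum being over all collections of pairwise disjoint cubes $\{Q_i\}_i$ in $[0,1]^n$. *)

(* Defs.v *)
From HB Require Import structures.
From mathcomp Require Import all_boot all_order all_algebra.
(* The notations of mpoly clash with those of MathComp-Analysis. *)
From mathcomp Require Import -(notations) mpoly.
From mathcomp Require Import all_classical all_reals all_analysis.

Set Implicit Arguments.
Unset Strict Implicit.
Unset Printing Implicit Defensive.

Import Order.TTheory GRing.Theory Num.Theory numFieldNormedType.Exports.
Local Open Scope classical_set_scope.
Local Open Scope ring_scope.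

Section borel_lebesgue.
Context {R : realType}.
Local Notation T := (measurableTypeR R).

Definition tcons (n : nat) (x : T * n.-tuple T) : n.+1.-tuple T :=
  [the n.+1.-tuple T of x.1 :: x.2].

Lemma measurable_tcons (n : nat) : measurable_fun setT (@tcons n).
Proof. exact: measurable_cons. Qed.

Section step.
Variables (n : nat) (mu : {sigma_finite_measure set (n.-tuple T) -> \bar R}).

Definition tcons_measure : set (n.+1.-tuple T) -> \bar R :=
  pushforward (lebesgue_measure \x mu)%E (@tcons n).

Let tcons_measure0 : tcons_measure set0 = 0%E.
Proof. by rewrite /tcons_measure /pushforward preimage_set0 measure0. Qed.

Let tcons_measure_ge0 A : (0 <= tcons_measure A)%E.
Proof. by rewrite /tcons_measure /pushforward. Qed.

Let tcons_measure_sigma_additive : semi_sigma_additive tcons_measure.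
Proof.
by apply: measure_semi_sigma_additive => //; exact: measurable_tcons.
Qed.

HB.instance Definition _ := isMeasure.Build _ _ _ tcons_measure
  tcons_measure0 tcons_measure_ge0 tcons_measure_sigma_additive.

Let tcons_measure_sigma_finite : sigma_finite setT tcons_measure.
Proof.
pose uncons (t : n.+1.-tuple T) : T * n.-tuple T :=
  (thead t, [tuple of behead t]).
have unconsK : cancel uncons (@tcons n).
  by move=> t; rewrite [RHS]tuple_eta; apply/val_inj.
have tconsK : cancel (@tcons n) uncons.
  by move=> [x t]; congr pair; apply/val_inj.
have muncons : measurable_fun setT uncons.
  apply/measurable_fun_pairP; split.
    exact: measurable_tnth.
  exact: measurable_behead.
have /sigma_finiteP[F [TF ndF Foo]] := sigma_finiteT (@lebesgue_measure R).
have /sigma_finiteP[G [TG ndG Goo]] := sigma_finiteT mu.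
exists (fun k => uncons @^-1` (F k `*` G k)).
  rewrite -preimage_bigcup (_ : \bigcup_k _ = setT) ?preimage_setT//.
  apply/seteqP; split=> // -[x y] _.
  have [i _ Fix] : (\bigcup_i F i) x by rewrite -TF.
  have [j _ Gjy] : (\bigcup_j G j) y by rewrite -TG.
  exists (maxn i j) => //; split => /=.
    by move: x Fix; exact/subsetPset/ndF/leq_maxl.
  by move: y Gjy; exact/subsetPset/ndG/leq_maxr.
move=> k; have [mF Fk] := Foo k; have [mG Gk] := Goo k; split.
  by rewrite -[X in measurable X]setTI; apply: muncons => //; exact: measurableX.
rewrite /tcons_measure /pushforward -comp_preimage.
rewrite (_ : uncons \o _ = id); last by apply/funext => z; exact: tconsK.
by rewrite preimage_id product_measure1E// lte_mul_pinfty// ge0_fin_numE.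
Qed.

HB.instance Definition _ :=
  Measure_isSigmaFinite.Build _ _ _ tcons_measure tcons_measure_sigma_finite.

End step.

(* Lebesgue measure on the Borel sets of R^n, as an iterated product measure *)
Fixpoint borel_lebesgue (n : nat) :
    {sigma_finite_measure set (n.-tuple T) -> \bar R} :=
  match n with
  | 0 => \d_[tuple]
  | n'.+1 => tcons_measure (borel_lebesgue n')
  end.

End borel_lebesgue.

Section spaces.
Context (R : realType) (n : nat).

(* R^n, carrying the sigma-algebra of Lebesgue measurable sets *)
Definition Rn : Type := caratheodory_type (mu_ext (@borel_lebesgue R n)).
HB.instance Definition _ := Measurable.on Rn.

Definition leb : set Rn -> \bar R :=
  @completed_measure_extension _ _ _ (borel_lebesgue n).
HB.instance Definition _ := Measure.on leb.

Implicit Types (f : Rn -> R) (Q : set Rn) (s : nat) (p q alpha lambda : R).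

Definition coord (x : Rn) (i : 'I_n) : R := tnth x i.

Definition unit_cube : set Rn := [set x | forall i, 0 <= coord x i <= 1].

(* Each face may or may not belong to the cube. *)
Definition is_cube Q := exists (a : 'I_n -> R) (l : R) (b c : 'I_n -> bool),
  0 < l /\ Q = [set x | forall i,
    coord x i \in Interval (BSide (b i) (a i)) (BSide (c i) (a i + l))].

(* Cubes have positive measure, so such a family is at most countable. *)
Definition cube_families : set (set (set Rn)) :=
  [set F | (forall Q, F Q -> is_cube Q /\ Q `<=` unit_cube) /\ trivIset F id].

Definition vol Q : R := fine (leb Q).

Definition peval (m : mpoly n R) (x : Rn) : R := meval (coord x) m.

(* msize is the total degree plus one, and 0 for the zero polynomial. *)
Definition polys s : set (mpoly n R) := [set m | (msize m <= s.+1)%N].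

Definition is_PQ s Q f (P : mpoly n R) := polys s P /\
  forall gamma : multinom n, (mdeg gamma <= s)%N ->
    (\int[leb]_(x in Q)
       ((f x - peval P x) * \prod_(i < n) coord x i ^+ gamma i)%:E = 0)%E.

(* For a cube Q and f integrable on Q there is exactly one such polynomial. *)
Definition PQ s Q f : mpoly n R := xget 0 (is_PQ s Q f).

Definition LqNorm q Q f : \bar R := 'N[leb]_(q%:E)[(EFin \o f) \_ Q]%E.

Definition JN_sum p q s alpha f (F : set (set Rn)) : \bar R :=
  (\esum_(Q in F) ((vol Q)%:E * ((vol Q `^ (- alpha))%:E *
     ((vol Q)^-1%:E *
        \int[leb]_(x in Q) (`|f x - peval (PQ s Q f) x| `^ q)%:E) `^ q^-1)
     `^ p))%E.

Definition JN_norm p q s alpha f : \bar R :=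
  ereal_sup [set (JN_sum p q s alpha f F `^ p^-1)%E | F in cube_families].

(* A function on the unit cube is represented by any extension to R^n; only its
   values on the unit cube matter below. *)
Definition JN_space p q s alpha : set (Rn -> R) :=
  [set f | leb.-integrable unit_cube (EFin \o f) /\
           (JN_norm p q s alpha f < +oo)%E].

Definition V_sum p q lambda s f (F : set (set Rn)) : \bar R :=
  (\esum_(Q in F) ((vol Q `^ (- lambda))%:E *
     ereal_inf [set LqNorm q Q (fun x => f x - peval m x)%R | m in polys s])
     `^ p)%E.

Definition V_norm p q lambda s f : \bar R :=
  ereal_sup [set (V_sum p q lambda s f F `^ p^-1)%E | F in cube_families].

Definition V_space p q lambda s : set (Rn -> R) :=
  [set f | measurable_fun unit_cube f /\ (LqNorm q unit_cube f < +oo)%E /\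
           (V_norm p q lambda s f < +oo)%E].

End spaces.

Arguments leb {R n}.
Arguments unit_cube {R n}.
Arguments JN_space {R} n p q s alpha.
Arguments V_space {R} n p q lambda s.

(* Main.v *)
Require Import Defs.
From mathcomp Require Import all_boot all_order all_algebra.
(* The notations of mpoly clash with those of MathComp-Analysis. *)
From mathcomp Require Import -(notations) mpoly.
From mathcomp Require Import all_classical all_reals all_analysis.
From mathcomp Require Import measurable_realfun zify lra.
Import Order.TTheory GRing.Theory Num.Theory numFieldNormedType.Exports.
Local Open Scope classical_set_scope.
Local Open Scope ring_scope.
Set Implicit Arguments.
Unset Strict Implicit.
Unset Printing Implicit Defensive.

(* The V-term of a cube Q is [|Q|^(-lambda) inf_m ||f - m||_q]^p, and since
   lambda = alpha + 1/q - 1/p the JN-term is the same expression with m = P_Q(f)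
   in place of the infimum. So V <= JN termwise, and the reverse bound reduces to
   ||f - P_Q(f)||_q <= C ||f - m||_q on Q, for every polynomial m of degree <= s,
   with C depending on n and s only.
   Let h = P_Q(f) - m. As f - P_Q(f) is orthogonal to h,
   int_Q h^2 = int_Q (f - m) h <= (sup_Q |h|) int_Q |f - m|,
   so that sup_Q h^2 <= (K / |Q|) int_Q h^2 gives
   sup_Q |h| <= (K / |Q|) int_Q |f - m|; conclude by Hoelder and Minkowski.
   The constant K is independent of Q without any change of variables: it comes
   from Lagrange interpolation in one variable, and from Fubini in several. *)

(* The interpolation nodes lie in d of 2d + 1 consecutive subintervals of equal
   length, every other one, hence are separated by such a length. *)
Definition nikolskii_cst {R : realType} (d : nat) : R :=
  d%:R * (2 * d + 1)%:R ^+ d.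

Lemma nikolskii_cst_ge0 {R : realType} d : 0 <= nikolskii_cst d :> R.
Proof. by rewrite /nikolskii_cst mulr_ge0// exprn_ge0. Qed.

Definition cube_side {R : realType} (a l : R) (b c : bool) : interval R :=
  Interval (BSide b a) (BSide c (a + l)).

(** * One variable: a nonnegative polynomial on an interval is bounded by its mean *)

Section univariate.
Context {R : realType}.

Lemma lebesgue_measure_side (a l : R) (b c : bool) : 0 < l ->
  lebesgue_measure [set` cube_side a l b c] = l%:E.
Proof.
move=> l0; rewrite lebesgue_measure_itv /cube_side /= lte_fin ltrDl l0.
by rewrite -EFinB addrC addKr.
Qed.

(** Each Lagrange basis polynomial at [x] is a product of [d.-1] ratios of distances
    [|x - t i| / |t j - t i|], each at most [l / h]. Since the values [p.[t j]] are nonnegative, the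
    basis polynomials can be replaced by their absolute values. *)
Lemma lagrange_le (d : nat) (p : {poly R}) (h l x : R) (t : nat -> R) :
  (0 < d)%N -> (size p <= d)%N -> 0 < h -> 0 <= l ->
  (forall i j : nat, i != j -> h <= `|t i - t j|) ->
  (forall j : nat, (j < d)%N -> `|x - t j| <= l) ->
  (forall j : nat, (j < d)%N -> 0 <= p.[t j]) ->
  p.[x] <= (l / h) ^+ d.-1 * \sum_(j < d) p.[t j].
Proof.
move=> d0 sp h0 l0 ht lt pt.
have tinj : injective t.
  move=> i j tij; apply/eqP/contraT => /ht; rewrite tij subrr normr0.
  by rewrite leNgt h0.
rewrite {1}(lagrange_gen d0 tinj sp) horner_sum mulr_sumr.
apply: ler_sum => /= j _; rewrite hornerM hornerC mulrC.
apply: ler_wpM2r; first exact: pt.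
rewrite lagrangeE// hornerM hornerC !horner_prod -prodfV -big_split/=.
apply: (le_trans (ler_norm _)); rewrite normr_prod.
have -> : (l / h) ^+ d.-1 = \prod_(i < d | i != j) (l / h).
  by rewrite prodr_const/= cardC1 card_ord.
apply: ler_prod => i ij; rewrite normr_ge0/= !hornerXsubC normrM normfV mulrC.
apply: ler_pM => //; first exact: lt.
rewrite lef_pV2// ?posrE//; first by rewrite ht// eq_sym.
by rewrite (lt_le_trans h0)// ht// eq_sym.
Qed.

Local Notation mu := (@lebesgue_measure R).

(** Interpolate at points where [p] is smallest on short subintervals: there the value times the
    length is below the integral, so [lagrange_le] turns into a bound by an integral. *)
Lemma poly_le_integral d (p : {poly R}) (a l x : R) (b c : bool) :
  (0 < d)%N -> (size p <= d)%N -> 0 < l -> a <= x <= a + l ->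
  (forall t, 0 <= p.[t]) ->
  ((p.[x] * l)%:E <= (nikolskii_cst d)%:E *
    \int[mu]_(t in [set` cube_side a l b c]) (p.[t])%:E)%E.
Proof.
move=> d0 sp l0 /andP[ax xl] p0; set I := [set` _].
set K := nikolskii_cst d.
pose N : R := (2 * d + 1)%:R.
have N0 : 0 < N by rewrite ltr0n addn1.
pose h := l / N.
have h0 : 0 < h by rewrite divr_gt0.
have hN : h * N = l by rewrite /h divfK// gt_eqF.
(* Among the 2d + 1 subintervals, numbered from 0, these are the odd ones. The first and the last
   are skipped, so [[u j, v j]] is interior and lies in the side whichever endpoints belong to
   it. *)
pose u (j : nat) := a + h * (2 * j + 1)%:R.
pose v (j : nat) := a + h * (2 * j + 2)%:R.
have E (j k : nat) : (2 * j + k)%:R = 2 * j%:R + k%:R :> R.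
  by rewrite natrD natrM.
have uv j : v j = u j + h.
  by rewrite /u /v !E !mulrDr !mulr1; lra.
(* The node [t j] minimises [p] on [[u j, v j]], whence [p.[t j] * h] is at most the integral of [p]
   there. *)
have /choice[t tP] : forall j : nat, exists c, c \in `[u j, v j] /\
    forall y, y \in `[u j, v j] -> p.[c] <= p.[y].
  move=> j; have [||z ? ?] := @EVT_min R (horner p) (u j) (v j); last by exists z.
    by rewrite uv lerDl ltW.
  by apply: continuous_subspaceT; exact: continuous_horner.
have tI j : u j <= t j <= v j by have [] := tP j; rewrite in_itv.
have tsep (i j : nat) : (i < j)%N -> h <= `|t i - t j|.
  move=> ij; have /andP[_ ti] := tI i; have /andP[tj _] := tI j.
  rewrite distrC ler_normr; apply/orP; left.
  have : v i + h <= u j.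
    have : (i.+1%:R <= j%:R :> R) by rewrite ler_nat.
    rewrite /v /u !E -natr1 => ij'.
    suff : 0 <= h * (j%:R - (i%:R + 1)) by lra.
    by rewrite mulr_ge0// ?(ltW h0)// subr_ge0.
  by lra.
have hsep (i j : nat) : i != j -> h <= `|t i - t j|.
  by rewrite neq_ltn => /orP[/tsep//|/tsep]; rewrite distrC.
have uv_in (j : nat) : (j < d)%N -> a < u j /\ v j < a + l.
  move=> jd; have j0 : 0 <= j%:R :> R by [].
  have : (j.+1%:R <= d%:R :> R) by rewrite ler_nat.
  rewrite -hN /u /v /N !E -natr1 => jd'.
  have := mulr_ge0 (ltW h0) j0.
  suff : 0 <= h * (d%:R - (j%:R + 1)) by lra.
  by rewrite mulr_ge0// ?(ltW h0)// subr_ge0.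
have txl (j : nat) : (j < d)%N -> `|x - t j| <= l.
  move=> /uv_in[au vl]; have /andP[ut tv] := tI j.
  by rewrite ler_norml; apply/andP; split; lra.
have := lagrange_le d0 sp h0 (ltW l0) hsep txl (fun j _ => p0 _).
have -> : l / h = N by rewrite -hN mulrC mulKf// gt_eqF.
move=> Hlag.
pose J := (\int[mu]_(t in I) (p.[t])%:E)%E.
have mp (A : set (measurableTypeR R)) :
    measurable_fun A (fun y : measurableTypeR R => (p.[y])%:E).
  apply/measurable_EFinP; apply/measurable_funTS.
  by apply: continuous_measurable_fun; exact: continuous_horner.
have HJ (j : 'I_d) : ((p.[t j] * h)%:E <= J)%E.
  have [au vl] := uv_in j (ltn_ord j).
  apply: (@le_trans _ _ (\int[mu]_(y in `[u j, v j]) (p.[y])%:E)%E).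
    apply: (@le_trans _ _ (\int[mu]_(y in `[u j, v j]) (p.[t j])%:E)%E).
      rewrite integral_cst// [X in (_ * X)%E](_ : _ = h%:E)//.
      by rewrite uv; exact: (lebesgue_measure_side (u j) true false h0).
    apply: ge0_le_integral => //=.
    - by move=> y _; rewrite lee_fin.
    - by move=> y uvy; rewrite lee_fin; apply: (tP j).2.
  apply: ge0_subset_integral => //=.
  - exact: measurable_itv.
  - by move=> y _; rewrite lee_fin.
  move=> y /=; rewrite /I/cube_side/= !in_itv/= => /andP[uy yv].
  rewrite (@lteifS _ _ _ _ b) ?(lt_le_trans au)//=.
  by rewrite (@lteifS _ _ _ _ (~~ c)) ?(le_lt_trans yv).
have J0 : (0 <= J)%E by apply: integral_ge0 => y _; rewrite lee_fin.
have : ((p.[x] * l)%:E <= (N ^+ d)%:E * \sum_(j < d) (p.[t j] * h)%:E)%E.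
  rewrite sumEFin -EFinM lee_fin -mulr_suml.
  (* Interpolation costs d - 1 factors [N]; the last one comes from [l = h * N]. *)
  have -> : N ^+ d = N * N ^+ d.-1 by rewrite -exprS prednK.
  rewrite [leRHS](_ : _ = N ^+ d.-1 * (\sum_(j < d) p.[t j]) * l); last first.
    by rewrite -hN -!mulrA mulrC -!mulrA.
  by rewrite ler_wpM2r// ltW.
move=> /le_trans; apply.
rewrite /K /nikolskii_cst -/N -/J [_ * _ ^+ _]mulrC EFinM -muleA.
apply: lee_wpmul2l; first by rewrite lee_fin exprn_ge0// ltW.
(* Each node is charged the whole integral [J], which gives the factor [d] of [nikolskii_cst]. *)
apply: (@le_trans _ _ (\sum_(j < d) J)%E); first exact: lee_sum.
by rewrite sumr_const card_ord mule_natl.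
Qed.
End univariate.

(** * Several variables: iteration of the one-variable bound over the coordinates of a box *)

Section borel_boxes.
Context {R : realType}.
Local Notation T := (measurableTypeR R).
Local Notation leb1 := (@lebesgue_measure R).

Definition box (n : nat) (a : 'I_n -> R) (l : R) (b c : 'I_n -> bool) :
    set (n.-tuple T) :=
  [set x | forall i, tnth x i \in cube_side (a i) l (b i) (c i)].

Lemma measurable_box n a l b c : measurable (@box n a l b c).
Proof.
have -> : box a l b c = \bigcap_(i in [set: 'I_n])
    ((@tnth n T)^~ i @^-1` [set` cube_side (a i) l (b i) (c i)]).
  by apply/seteqP; split => x /= H i; [move=> _; exact: H|exact: (H i I)].
apply: fin_bigcap_measurable => // i _; rewrite -[X in measurable X]setTI.
by apply: measurable_tnth => //; exact: measurable_itv.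
Qed.

Lemma tcons_box n a l b c : @tcons R n @^-1` (@box n.+1 a l b c) =
  [set` cube_side (a ord0) l (b ord0) (c ord0)] `*`
  box (a \o lift ord0) l (b \o lift ord0) (c \o lift ord0).
Proof.
apply/seteqP; split=> -[t y] /=.
  move=> H; split=> [|i]; first exact: (H ord0).
  by have := H (lift ord0 i); rewrite tnthS.
by move=> [H0 H] i; case: (unliftP ord0 i) => [j|] ->; rewrite ?tnthS//; exact: H.
Qed.

Lemma borel_lebesgue_box n a l b c : 0 < l ->
  borel_lebesgue n (@box n a l b c) = (l ^+ n)%:E.
Proof.
move=> l0; elim: n => [|n IH] in a b c *.
  rewrite /= diracE [_ \in _]mem_set// => -[] //.
rewrite /= /tcons_measure /pushforward tcons_box product_measure1E//.
- rewrite [X in (X * _)%E](_ : _ = l%:E); last exact: lebesgue_measure_side.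
  by rewrite IH -EFinM exprS.
- exact: measurable_box.
Qed.

(** Polynomial with fewer than [d + 1] coefficients in each variable, the others being frozen. The
    recursion peels off the first coordinate, as [borel_lebesgue] does, so that it follows the
    induction by Tonelli. *)
Fixpoint separately_poly (d n : nat) : (n.-tuple T -> R) -> Prop :=
  match n with
  | 0 => fun=> True
  | n'.+1 => fun F =>
      (forall y, exists2 p : {poly R}, (size p <= d)%N &
         forall t, F (tcons (t, y)) = p.[t]) /\
      (forall t, separately_poly d (fun y => F (tcons (t, y))))
  end.

(** Induction on [n]: freeze the tail of [x] and apply the one-variable bound in the first
    coordinate [t]; then, for each [t], bound the value at that tail by the integral over the
    remaining coordinates. Every coordinate contributes one factor [nikolskii_cst d]. *)
Lemma separately_poly_le_integral d n (F : n.-tuple T -> R) a l b c x :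
  (0 < d)%N -> 0 < l -> measurable_fun setT F -> separately_poly d F ->
  (forall y, 0 <= F y) -> (forall i, a i <= tnth x i <= a i + l) ->
  ((F x * l ^+ n)%:E <= (nikolskii_cst d ^+ n)%:E *
     \int[borel_lebesgue n]_(y in box a l b c) (F y)%:E)%E.
Proof.
move=> d0 l0; elim: n => [|n IH] in F a b c x *.
  move=> mF _ F0 _.
  rewrite !expr0 mulr1 mul1e /= integral_dirac//; last 2 first.
    exact: measurable_box.
    by apply/measurable_EFinP; exact: measurable_funTS.
  rewrite diracE [_ \in _]mem_set ?mul1e; last by case.
  by rewrite lee_fin (tuple0 x).
move=> mF [sp1 sp] F0 xI.
have Hd := @poly_le_integral R d; have K0 := @nikolskii_cst_ge0 R d.
move: (nikolskii_cst d) IH Hd K0 => K IH Hd K0.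
set I1 := [set` cube_side (a ord0) l (b ord0) (c ord0)].
set B := box (a \o lift ord0) l (b \o lift ord0) (c \o lift ord0).
have mI1 : measurable I1 by exact: measurable_itv.
have mB : measurable B by exact: measurable_box.
have mcons : measurable_fun setT (@tcons R n) by exact: measurable_tcons.
have mFc : measurable_fun setT (fun z : T * n.-tuple T => (F (tcons z))%:E).
  by apply/measurable_EFinP; exact: measurableT_comp.
(* Extension by zero, because Tonelli's theorem is applied on the whole product space; [GE] cuts
   back to [I1] and [B]. *)
pose H := (fun z => (F (tcons z))%:E) \_ (I1 `*` B).
have mH : measurable_fun setT H.
  apply/(measurable_restrictT _ _).1 => //; first exact: measurableX.
  exact: measurable_funTS.
have H0 z : (0 <= H z)%E by apply: erestrict_ge0 => y _; rewrite lee_fin.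
pose G t : \bar R := (\int[borel_lebesgue n]_(y in B) (F (tcons (t, y)))%:E)%E.
have GE : (\int[borel_lebesgue n.+1]_(y in box a l b c) (F y)%:E =
    \int[leb1]_(t in I1) G t)%E.
  rewrite /= (ge0_integral_pushforward mcons)//; last 3 first.
    exact: measurable_box.
    by apply/measurable_EFinP; exact: measurable_funTS.
    by move=> y _; rewrite lee_fin.
  rewrite tcons_box integral_mkcond.
  transitivity (\int[leb1]_t fubini_F (borel_lebesgue n) H t)%E.
    exact: (@fubini_tonelli1 _ _ _ _ _ leb1 (borel_lebesgue n) H).
  rewrite [RHS]integral_mkcond; apply: eq_integral => t _.
  rewrite /fubini_F /H patchE; case: ifPn => It.
    rewrite /G [RHS]integral_mkcond; apply: eq_integral => y _.
    by rewrite !patchE in_setX/= It.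
  rewrite integral0_eq// => y _.
  by rewrite patchE in_setX/= (negbTE It).
have mG : measurable_fun I1 G.
  apply: (@eq_measurable_fun _ _ _ _ _ (fubini_F (borel_lebesgue n) H)).
    move=> t tI; rewrite /fubini_F /G [RHS]integral_mkcond.
    by apply: eq_integral => y _; rewrite /H !patchE in_setX/= tI.
  by apply: measurable_funTS; exact: measurable_fun_fubini_tonelli_F.
have G0 t : (0 <= G t)%E by apply: integral_ge0 => y _; rewrite lee_fin.
have -> : x = tcons (thead x, [tuple of behead x]).
  by rewrite [LHS]tuple_eta; apply/val_inj.
set y0 := [tuple of behead x].
have [p sizep pE] := sp1 y0.
have := Hd p (a ord0) l (thead x) (b ord0) (c ord0) d0 sizep l0
  (xI ord0).
have p0 t : 0 <= p.[t] by rewrite -pE.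
move=> /(_ p0) Hp.
rewrite pE GE exprS mulrA EFinM.
apply: (@le_trans _ _ ((K%:E * \int[leb1]_(t in I1) (p.[t])%:E) * (l ^+ n)%:E)%E).
  by apply: lee_wpmul2r => //; rewrite lee_fin exprn_ge0// ltW.
rewrite exprS (EFinM K) -!muleA; apply: lee_wpmul2l; first by rewrite lee_fin.
have mp : measurable_fun I1 (fun t => (p.[t])%:E).
  apply/measurable_EFinP; apply: measurable_funTS.
  by apply: continuous_measurable_fun; exact: continuous_horner.
(* The factors [l ^+ n] and [K ^+ n] go under the integral over [t], where the induction hypothesis
   compares the integrands pointwise. *)
rewrite muleC -ge0_integralZl//; last 2 first.
  by move=> t _; rewrite lee_fin.
  by rewrite lee_fin exprn_ge0// ltW.
rewrite -ge0_integralZl//; last by rewrite lee_fin exprn_ge0.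
apply: ge0_le_integral => //.
- by move=> t _; rewrite mule_ge0// lee_fin// exprn_ge0// ltW.
- by apply: measurable_funeM.
- by apply: measurable_funeM.
- move=> t _; rewrite -EFinM mulrC -pE.
  apply: (IH (fun y => F (tcons (t, y)))) => //.
  + apply: measurableT_comp => //; apply: measurableT_comp => //.
  + exact: sp.
  + move=> i; by have := xI (lift ord0 i); rewrite [x in tnth x]tuple_eta tnthS.
Qed.

Lemma separately_poly_scale d n k (F : n.-tuple T -> R) :
  separately_poly d F -> separately_poly d (fun y => k * F y).
Proof.
elim: n F => [//|n IH] F [F1 F2]; split=> [y|t]; last exact: (IH _ (F2 t)).
have [p sp pE] := F1 y; exists (k *: p) => [|t]; last by rewrite pE hornerZ.
exact: leq_trans (size_scale_leq _ _) sp.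
Qed.

Lemma separately_poly_add d n (F G : n.-tuple T -> R) :
  separately_poly d F -> separately_poly d G ->
  separately_poly d (fun y => F y + G y).
Proof.
elim: n F G => [//|n IH] F G [F1 F2] [G1 G2].
split=> [y|t]; last exact: (IH _ _ (F2 t) (G2 t)).
have [p sp pE] := F1 y; have [q sq qE] := G1 y.
exists (p + q) => [|t]; last by rewrite pE qE hornerD.
by rewrite (leq_trans (size_polyD _ _))// geq_max sp.
Qed.

Lemma separately_poly0 d n : separately_poly d (fun=> 0 : R) (n := n).
Proof.
elim: n => [//|n IH]; split=> [y|//]; exists 0 => [|t]; last by rewrite horner0.
by rewrite size_poly0.
Qed.

Lemma separately_poly_sum d n (I : eqType) (r : seq I)
    (F : I -> n.-tuple T -> R) :
  (forall i, i \in r -> separately_poly d (F i)) ->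
  separately_poly d (fun y => \sum_(i <- r) F i y).
Proof.
elim: r => [|i r IH] dF.
  by under eq_fun do rewrite big_nil; exact: separately_poly0.
under eq_fun do rewrite big_cons.
apply: separately_poly_add; first by apply: dF; rewrite mem_head.
by apply: IH => j jr; apply: dF; rewrite inE jr orbT.
Qed.

Lemma separately_poly_monomial d n (m : 'I_n -> nat) : (forall i, (m i < d)%N) ->
  separately_poly d (fun y : n.-tuple T => \prod_(i < n) tnth y i ^+ m i).
Proof.
elim: n m => [//|n IH] m md; split=> [y|t].
  exists ((\prod_(i < n) tnth y i ^+ m (lift ord0 i)) *: 'X^(m ord0)) => [|t].
    by rewrite (leq_trans (size_scale_leq _ _))// size_polyXn.
  rewrite hornerZ hornerXn big_ord_recl mulrC; congr (_ * _).
  by apply: eq_bigr => i _; rewrite tnthS.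
rewrite (_ : (fun y => _) = fun y : n.-tuple T =>
    t ^+ m ord0 * \prod_(i < n) tnth y i ^+ m (lift ord0 i)).
  by apply: separately_poly_scale; exact: IH.
apply/funext => y; rewrite big_ord_recl; congr (_ * _).
by apply: eq_bigr => i _; rewrite tnthS.
Qed.

End borel_boxes.

(** Serves with [phi] the identity from the Lebesgue to the Borel sigma-algebra, where the two
    measures agree on Borel sets. *)
Lemma ge0_integral_image_measure d1 d2 (X : measurableType d1)
    (Y : measurableType d2) (R : realType) (phi : X -> Y)
    (mu : {measure set X -> \bar R}) (nu : {measure set Y -> \bar R})
    (D : set Y) (F : Y -> \bar R) :
  measurable_fun setT phi ->
  (forall A, measurable A -> mu (phi @^-1` A) = nu A) ->
  measurable D -> measurable_fun D F -> (forall y, 0 <= F y)%E ->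
  (\int[nu]_(y in D) F y = \int[mu]_(x in phi @^-1` D) F (phi x))%E.
Proof.
move=> mphi munu mD mF F0.
rewrite -(ge0_integral_pushforward mphi _ mD mF) => [|y _]; last exact: F0.
by apply: eq_measure_integral => A mA _; rewrite -munu.
Qed.

(** The constant K of the sup bound: a square of a polynomial of degree at most s has at most 2s + 1
    coefficients in each variable, and there is one factor per coordinate. *)
Definition cube_cst {R : realType} (n s : nat) : R :=
  nikolskii_cst (s + s).+1 ^+ n.

(** * Transfer from Borel boxes to cubes with Lebesgue measure *)

Section lebesgue.
Context {R : realType} {n : nat}.
Local Notation T := (measurableTypeR R).
Implicit Types (Q : set (Rn R n)) (h : mpoly n R).

Lemma measurable_Rn (A : set (n.-tuple T)) :
  measurable A -> measurable (A : set (Rn R n)).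
Proof.
by move=> mA; apply: sub_caratheodory; exact: sub_sigma_algebra.
Qed.

Lemma lebE (A : set (n.-tuple T)) : measurable A -> leb A = borel_lebesgue n A.
Proof. by move=> mA; exact: measurable_mu_extE. Qed.

Lemma measurable_Rn_id : measurable_fun setT (id : Rn R n -> n.-tuple T).
Proof. by move=> _ A mA; rewrite setTI; exact: measurable_Rn. Qed.

Lemma ge0_integral_leb (D : set (n.-tuple T)) (F : n.-tuple T -> \bar R) :
  measurable D -> measurable_fun setT F -> (forall x, 0 <= F x)%E ->
  (\int[leb]_(x in (D : set (Rn R n))) F x =
   \int[borel_lebesgue n]_(x in D) F x)%E.
Proof.
move=> mD mF F0; apply/esym.
apply: (ge0_integral_image_measure measurable_Rn_id lebE mD) => //.
exact: measurable_funTS.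
Qed.

Lemma measurable_meval h :
  measurable_fun setT (fun x : n.-tuple T => meval (tnth x) h).
Proof.
under eq_fun do rewrite mevalE.
apply: measurable_sum => m; apply: measurable_funM; first exact: measurable_cst.
apply: measurable_prod => i _; apply: measurable_funX.
exact: measurable_tnth.
Qed.

Lemma measurable_peval h : measurable_fun setT (peval h : Rn R n -> R).
Proof. exact: (measurableT_comp (measurable_meval h) measurable_Rn_id). Qed.

Lemma cube_box Q : is_cube Q -> exists a l b c, 0 < l /\ Q = box a l b c.
Proof. by move=> [a [l [b [c [l0 ->]]]]];
exists a, l, b, c. Qed.

Lemma measurable_cube Q : is_cube Q -> measurable Q.
Proof.
move=> /cube_box[a [l [b [c [_ ->]]]]].
exact: (measurable_Rn (measurable_box a l b c)).
Qed.

Lemma leb_cube Q : is_cube Q -> 0 < vol Q /\ leb Q = (vol Q)%:E.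
Proof.
move=> /cube_box[a [l [b [c [l0 ->]]]]].
rewrite /vol lebE; last exact: measurable_box.
by rewrite borel_lebesgue_box//=; split=> //; exact: exprn_gt0.
Qed.

Lemma separately_poly_meval d h : (msize h <= d)%N ->
  separately_poly d (fun x : n.-tuple T => meval (tnth x) h).
Proof.
move=> hd; under eq_fun do rewrite mevalE.
apply: separately_poly_sum => m mh.
apply: separately_poly_scale; apply: separately_poly_monomial => i.
apply: leq_trans hd; apply: leq_ltn_trans (msize_mdeg_lt mh).
by rewrite mdegE (bigD1 i)//= leq_addr.
Qed.

(* The square of h is nonnegative, and of degree at most 2s in each variable. *)
Lemma peval_sqr_le s Q h x : is_cube Q -> polys s h -> Q x ->
  (((peval h x) ^+ 2 * vol Q)%:E <=
   (cube_cst n s)%:E * \int[leb]_(y in Q) (peval h y ^+ 2)%:E)%E.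
Proof.
move=> /[dup] cQ /cube_box[a [l [b [c [l0 QE]]]]] hs Qx.
have -> : vol Q = l ^+ n.
  by rewrite /vol QE lebE ?borel_lebesgue_box//; exact: measurable_box.
have E y : peval h y ^+ 2 = meval (tnth (y : n.-tuple T)) (h * h).
  by rewrite mevalM expr2.
have hh : (msize (h * h) <= (s + s).+1)%N.
  have [->|h0] := eqVneq h 0; first by rewrite mul0r msize0.
  rewrite msizeM//; move: hs; rewrite /polys/=; move: (msize h) => k ks.
  by rewrite -subn1 leq_subLR add1n -addSn -addnS leq_add.
rewrite QE; under eq_integral do rewrite E.
rewrite ge0_integral_leb; last 3 first.
- exact: measurable_box.
- by apply/measurable_EFinP; exact: measurable_meval.
- by move=> y; rewrite -E lee_fin sqr_ge0.
rewrite E; apply: separately_poly_le_integral => //.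
- exact: measurable_meval.
- exact: separately_poly_meval.
- by move=> y; rewrite -E sqr_ge0.
- move=> i; move: Qx; rewrite QE => /(_ i); rewrite /cube_side in_itv/=.
  by move=> /andP[/lteifW -> /lteifW ->].
Qed.

End lebesgue.

(** * Moments on a cube: existence of P_Q(f) and its distance to other polynomials *)

Section moments.
Context {R : realType} {n : nat}.
Variable Q : set (Rn R n).
Hypothesis cQ : is_cube Q.
Implicit Types (g : Rn R n -> R) (h : mpoly n R).

Local Notation integrable g := (leb.-integrable Q (EFin \o g)).

Let mQ : measurable Q. Proof. exact: measurable_cube. Qed.

Lemma bounded_peval h : exists2 M, 0 <= M & forall x, Q x -> `|peval h x| <= M.
Proof.
have [a [l [b [c [l0 QE]]]]] := cube_box cQ.
(* On the cube, coordinate [i] is at most [|a i| + l] in absolute value. *)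
exists (\sum_(m <- msupp h) `|mcoeff m h| * \prod_i (`|a i| + l) ^+ m i) => [|x].
  apply: sumr_ge0 => m _; apply: mulr_ge0 => //; apply: prodr_ge0 => i _.
  by rewrite exprn_ge0// addr_ge0// ltW.
rewrite QE => Bx; rewrite /peval mevalE (le_trans (ler_norm_sum _ _ _))//.
apply: ler_sum => m _; rewrite normrM ler_wpM2l// normr_prod.
apply: ler_prod => i _; rewrite normr_ge0/= normrX.
rewrite lerXn2r ?nnegrE ?addr_ge0// ?(ltW l0)//.
have := Bx i; rewrite /cube_side in_itv/= => /andP[/lteifW ax /lteifW xa].
rewrite /Defs.coord -{1}(subrK (a i) (tnth x i)) (le_trans (ler_normD _ _))//.
by rewrite addrC lerD2l ger0_norm ?subr_ge0// lerBlDl.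
Qed.

Lemma integrable_Mpeval g h : integrable g -> integrable (fun x => g x * peval h x).
Proof.
move=> ig; have [M M0 hM] := bounded_peval h.
have mg : measurable_fun Q g by apply/measurable_EFinP; exact: measurable_int ig.
apply: (le_integrable mQ _ _ (integrableZl mQ M ig)).
  apply/measurable_EFinP/measurable_funM => //.
  by apply: measurable_funTS; exact: measurable_peval.
move=> x Qx; rewrite /= lee_fin normrM mulrC [leRHS]normrM ler_wpM2r//.
by rewrite (ger0_norm M0) hM.
Qed.

Lemma integrable_peval h : integrable (peval h).
Proof.
have i1 : integrable (fun=> 1).
  apply/integrableP; split; first exact: measurable_cst.
  under eq_integral do rewrite /= normr1.
  by rewrite integral_cst// mul1e -[ltLHS]/(leb Q) (leb_cube cQ).2 ltry.
by have := integrable_Mpeval h i1; under eq_fun do rewrite mul1r.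
Qed.

Lemma integrableB_peval g h : integrable g -> integrable (fun x => g x - peval h x).
Proof. by move=> ig; exact: (integrableB mQ ig (integrable_peval h)). Qed.

Definition moment g h : R := fine (\int[leb]_(x in Q) (g x * peval h x)%:E)%E.

Lemma momentE g h : integrable g ->
  (\int[leb]_(x in Q) (g x * peval h x)%:E)%E = (moment g h)%:E.
Proof.
by move=> /(integrable_Mpeval h) i; rewrite fineK//; exact: integrable_fin_num.
Qed.

Lemma moment_sum g (I : Type) (r : seq I) (k : I -> R) (e : I -> mpoly n R) :
  integrable g ->
  moment g (\sum_(i <- r) k i *: e i) = \sum_(i <- r) k i * moment g (e i).
Proof.
move=> ig; apply: EFin_inj; rewrite -momentE// -sumEFin.
have pE x : (g x * peval (\sum_(i <- r) k i *: e i) x)%:E =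
    (\sum_(i <- r) (k i)%:E * (g x * peval (e i) x)%:E)%E.
  rewrite sumEFin; congr EFin.
  rewrite /peval raddf_sum mulr_sumr; apply: eq_bigr => i _.
  by rewrite /= mevalZ mulrCA.
under eq_integral do rewrite pE.
rewrite integral_sum// => [|i]; last first.
  exact: (integrableZl mQ (k i) (integrable_Mpeval (e i) ig)).
apply: eq_bigr => i _; rewrite integralZl//; last exact: integrable_Mpeval.
by rewrite momentE.
Qed.

Lemma momentB g g' h : integrable g -> integrable g' ->
  moment (fun x => g x - g' x) h = moment g h - moment g' h.
Proof.
move=> ig ig'; apply: EFin_inj.
have ib : integrable (fun x => g x - g' x) by exact: (integrableB mQ ig ig').
rewrite -momentE//.
under eq_integral do rewrite mulrBl EFinB.
by rewrite integralB_EFin ?momentE//; exact: integrable_Mpeval.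
Qed.

Lemma moment_peval_sum h (I : Type) (r : seq I) (k : I -> R) (e : I -> mpoly n R) :
  moment (peval (\sum_(i <- r) k i *: e i)) h =
  \sum_(i <- r) k i * moment (peval (e i)) h.
Proof.
have C p q : moment (peval p) q = moment (peval q) p.
  by rewrite /moment; under eq_integral do rewrite mulrC.
rewrite C moment_sum ?integrable_peval//.
by apply: eq_bigr => i _; rewrite C.
Qed.

Lemma moment_eq0 s g : integrable g ->
  (forall m : multinom n, (mdeg m <= s)%N -> moment g (mpolyX R m) = 0) ->
  forall h, polys s h -> moment g h = 0.
Proof.
move=> ig g0 h hs; rewrite [h]mpolyE moment_sum// big_seq big1// => m mh.
by rewrite g0 ?mulr0//; have := msize_mdeg_lt mh; move: hs; rewrite /polys/=; lia.
Qed.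

Lemma peval_sqr_le_moment s h x : polys s h -> Q x ->
  peval h x ^+ 2 * vol Q <= cube_cst n s * moment (peval h) h.
Proof.
move=> hs Qx; have := peval_sqr_le cQ hs Qx.
by under eq_integral do rewrite expr2; rewrite momentE ?integrable_peval// lee_fin.
Qed.

(* The moments of f form a vector b orthogonal to the kernel of the Gram matrix
   G: if G v = 0 then the polynomial with coefficients v has zero L^2 norm on Q,
   hence vanishes on Q. So b lies in the row space of G. *)
Lemma is_PQ_exists s g : integrable g -> exists P, is_PQ s Q g P.
Proof.
(* [bmultinom] bounds the degree strictly, hence [s.+1]; being finite, it can index the Gram matrix
   [G]. *)
move=> ig; pose I : finType := bmultinom n s.+1.
pose e (i : 'I_#|I|) : mpoly n R := mpolyX R (bmnm (enum_val i : I)).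
have es (i : 'I_#|I|) : (mdeg (bmnm (enum_val i : I)) <= s)%N by rewrite -ltnS bmdeg.
have sum_polys (k : 'I_#|I| -> R) : polys s (\sum_i k i *: e i).
  rewrite /polys/= (leq_trans (msize_sum _ _ _))//; apply/bigmax_leqP_seq => i _ _.
  by rewrite (leq_trans (msizeZ_le _ _))// msizeX ltnS.
pose G : 'M[R]_#|I| := \matrix_(i, j) moment (peval (e i)) (e j).
pose b : 'rV[R]_#|I| := \row_j moment g (e j).
have eP (w : Rn R n -> R) : (forall i, moment w (e i) = 0) ->
    forall m : multinom n, (mdeg m <= s)%N -> moment w (mpolyX R m) = 0.
  move=> w0 m ms; have := w0 (enum_rank (BMultinom (ms : (mdeg m < s.+1)%N))).
  by rewrite /e enum_rankK.
have /submxP[k bE] : (b <= G)%MS.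
  rewrite submxE; apply/eqP/rowP => j; rewrite mxE [RHS]mxE.
  (* Column [j] of the cokernel is a vector [v] with G v = 0. By symmetry of [G], [h] is then
     orthogonal to every [e i], hence to itself. *)
  pose v i := cokermx G i j; pose h := \sum_i v i *: e i.
  have h0 : moment (peval h) h = 0.
    apply: (moment_eq0 (integrable_peval h) (eP _ _) (sum_polys v)) => i.
    have := congr1 (fun A : 'M[R]_#|I| => A i j) (mulmx_coker G).
    rewrite !mxE => <-; rewrite moment_peval_sum; apply: eq_bigr => i' _.
    rewrite mxE mulrC /v; congr (_ * _).
    by rewrite /moment; under eq_integral do rewrite mulrC.
  have hQ x : Q x -> peval h x = 0.
    move=> Qx; apply/eqP; rewrite -sqrf_eq0 eq_le sqr_ge0 andbT.
    have := peval_sqr_le_moment (sum_polys v) Qx; rewrite -/h h0 mulr0.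
    by rewrite pmulr_lle0//; have [] := leb_cube cQ.
  transitivity (moment g h).
    rewrite moment_sum//; apply: eq_bigr => i _.
    by rewrite mxE mulrC.
  rewrite /moment (_ : integral _ _ _ = 0%E)//.
  by apply: integral0_eq => x Qx; rewrite hQ// mulr0.
exists (\sum_i k ord0 i *: e i); split; first exact: sum_polys.
move=> m ms; set P := \sum_i _.
have -> : (\int[leb]_(x in Q) ((g x - peval P x) *
    \prod_(i < n) Defs.coord x i ^+ m i)%:E)%E =
    (\int[leb]_(x in Q) ((g x - peval P x) * peval (mpolyX R m) x)%:E)%E.
  by apply: eq_integral => x _; rewrite /peval mevalX.
rewrite momentE; last exact: integrableB_peval.
congr EFin; apply: eP ms => j.
rewrite momentB ?integrable_peval//.
have := congr1 (fun A : 'rV[R]_#|I| => A ord0 j) bE; rewrite !mxE => ->.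
by rewrite moment_peval_sum; under eq_bigr do rewrite mxE; rewrite subrr.
Qed.

Lemma PQ_spec s g : integrable g -> is_PQ s Q g (PQ s Q g).
Proof.
by move=> /is_PQ_exists -/(_ s)[P HP]; rewrite /PQ; case: xgetP => [//|/(_ P)].
Qed.

Lemma moment_PQ s g h : integrable g -> polys s h ->
  moment (fun x => g x - peval (PQ s Q g) x) h = 0.
Proof.
move=> ig; have [_ Pg] := PQ_spec s ig.
apply: moment_eq0; first exact: integrableB_peval.
move=> m ms; rewrite /moment -[RHS]/(fine 0%E) -(Pg m ms).
by congr fine; apply: eq_integral => x _; rewrite /peval mevalX.
Qed.

Lemma polysB s h1 h2 : polys s h1 -> polys s h2 -> polys s (h1 - h2).
Proof.
rewrite /polys/= => h1s h2s; rewrite (leq_trans (msizeD_le _ _))//.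
by rewrite geq_max h1s msizeN.
Qed.

Lemma PQ_dist s g m x : integrable g -> polys s m -> Q x ->
  `|peval (PQ s Q g) x - peval m x| * vol Q <=
  cube_cst n s * fine (\int[leb]_(y in Q) `|g y - peval m y|%:E)%E.
Proof.
move=> ig ms Qx; have [Ps _] := PQ_spec s ig.
set P := PQ s Q g in Ps *; pose h := P - m.
have hs : polys s h by exact: polysB.
have pBE y : peval P y - peval m y = peval h y by rewrite /peval mevalB.
have [V0 _] := leb_cube cQ.
set K := cube_cst n s; have K0 : 0 <= K by rewrite exprn_ge0// nikolskii_cst_ge0.
pose u y := g y - peval m y; set U := fine _.
have iu : integrable u by exact: integrableB_peval.
have iU : leb.-integrable Q (fun y => `|u y|%:E) by exact: integrable_norm.
have UE : (\int[leb]_(y in Q) `|u y|%:E)%E = U%:E.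
  by rewrite fineK//; exact: integrable_fin_num.
have U0 : 0 <= U by apply: fine_ge0; apply: integral_ge0 => y _; rewrite lee_fin.
pose A := moment (peval h) h.
(* Here [u - h] is [g - P], which is orthogonal to [h]. *)
have AE : A = moment u h.
  apply/eqP; rewrite -subr_eq0 -opprB oppr_eq0 -momentB ?integrable_peval//.
  apply/eqP; rewrite -[RHS](moment_PQ ig hs); congr fine.
  by apply: eq_integral => y _; rewrite -pBE /u opprB addrA subrK.
have A0 : 0 <= A.
  apply: fine_ge0; apply: integral_ge0 => y _; rewrite lee_fin -expr2.
  exact: sqr_ge0.
(* [B] stands in for the supremum of |h| on Q: it is an upper bound by [peval_sqr_le_moment], and
   its square is known exactly. *)
pose B := Num.sqrt (K * A / vol Q).
have B0 : 0 <= B by exact: sqrtr_ge0.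
have BV : B ^+ 2 * vol Q = K * A.
  by rewrite sqr_sqrtr ?divfK ?gt_eqF// divr_ge0 ?mulr_ge0// ltW.
have hB y : Q y -> `|peval h y| <= B.
  move=> Qy; rewrite -(ler_pXn2r (n := 2))// ?nnegrE// real_normK ?num_real//.
  by rewrite -(ler_pM2r V0) BV; exact: peval_sqr_le_moment.
have AB : A <= B * U.
  rewrite -lee_fin AE -momentE// EFinM -UE -integralZl//.
  apply: le_integral => //; first exact: integrable_Mpeval.
    exact: integrableZl.
  move=> y; rewrite inE => Qy; rewrite lee_fin (le_trans (ler_norm _))// normrM.
  by rewrite mulrC ler_wpM2r// hB.
rewrite pBE; apply: (@le_trans _ _ (B * vol Q)).
  by rewrite ler_wpM2r ?(ltW V0)// hB.
(* From [B ^+ 2 * vol Q = K * A] and [A <= B * U] one factor [B] is cancelled, which requires it to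
   be nonzero. *)
have [->|Bn0] := eqVneq B 0; first by rewrite mul0r mulr_ge0.
have Bp : 0 < B by rewrite lt_def Bn0.
by rewrite -(ler_pM2l Bp) mulrA -expr2 BV mulrCA ler_wpM2l.
Qed.

End moments.

(** * Minkowski and Hölder inequalities for norms restricted to a set *)

Section Lnorm_on.
Context d (T : measurableType d) (R : realType) (mu : {measure set T -> \bar R}).
Implicit Types (Q : set T) (g : T -> R) (q : R).

Local Notation N q Q g := (Lnorm mu q%:E ((EFin \o g) \_ Q)).

Lemma Lnorm_onE q Q g : q != 0 ->
  N q Q g = ((\int[mu]_(x in Q) (`|g x| `^ q)%:E) `^ q^-1)%E.
Proof.
move=> q0; rewrite unlock; congr (_ `^ _)%E.
rewrite [RHS]integral_mkcond; apply: eq_integral => x _.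
rewrite !patchE; case: ifPn => // _.
by rewrite abse0 poweR0r.
Qed.

Lemma Lnorm_on_restrict q Q g : N q Q g = Lnorm mu q%:E (EFin \o (g \_ Q)).
Proof. by rewrite restrict_EFin. Qed.

Lemma measurable_patch Q g : measurable Q -> measurable_fun Q g ->
  measurable_fun setT (g \_ Q).
Proof. by move=> mQ mg; apply/(measurable_restrictT _ mQ). Qed.

Lemma Lnorm_on_triangle q Q g1 g2 : 1 <= q -> measurable Q ->
  measurable_fun Q g1 -> measurable_fun Q g2 ->
  (N q Q (fun x => g1 x + g2 x)%R <= N q Q g1 + N q Q g2)%E.
Proof.
move=> q1 mQ mg1 mg2; rewrite !Lnorm_on_restrict.
have -> : (fun x => g1 x + g2 x) \_ Q = (g1 \_ Q) \+ (g2 \_ Q).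
  by apply/funext => x /=; rewrite !patchE; case: ifPn => // _; rewrite addr0.
exact: (minkowski_EFin mu (measurable_patch mQ mg1) (measurable_patch mQ mg2) q1).
Qed.

Lemma Lnorm_on_bounded q Q g (C V : R) : 1 <= q -> measurable Q ->
  mu Q = V%:E -> measurable_fun Q g -> 0 <= C ->
  (forall x, Q x -> `|g x| <= C) ->
  (N q Q g <= (C * V `^ q^-1)%:E)%E.
Proof.
move=> q1 mQ QV mg C0 gC; have q0 : 0 < q by rewrite (lt_le_trans _ q1).
have V0 : 0 <= V by rewrite -lee_fin -QV.
have -> : C * V `^ q^-1 = (C `^ q * V) `^ q^-1.
  by rewrite powRM ?powR_ge0// -powRrM mulfV ?gt_eqF// powRr1.
rewrite Lnorm_onE ?gt_eqF// -poweR_EFin; apply: gt0_ler_poweR.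
- by rewrite invr_ge0 ltW.
- by rewrite in_itv/= leey andbT integral_ge0// => x _; rewrite lee_fin powR_ge0.
- by rewrite in_itv/= leey andbT lee_fin mulr_ge0// powR_ge0.
have -> : (C `^ q * V)%:E = (\int[mu]_(x in Q) (C `^ q)%:E)%E.
  by rewrite integral_cst// EFinM -QV.
apply: ge0_le_integral => //.
- apply/measurable_EFinP; apply: (measurableT_comp (measurable_powR _)).
  exact: measurableT_comp.
- by move=> x Qx; rewrite lee_fin ge0_ler_powR ?nnegrE// ?gC// ltW.
Qed.

(** Hölder's inequality for [g] against the indicator of [Q]. *)
Lemma integral_le_Lnorm_on q Q g (V : R) : 1 <= q -> measurable Q ->
  mu Q = V%:E -> measurable_fun Q g ->
  (\int[mu]_(x in Q) `|g x|%:E <= N q Q g * (V `^ (1 - q^-1))%:E)%E.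
Proof.
move=> q1 mQ QV mg; have q0 : 0 < q by rewrite (lt_le_trans _ q1).
have V0 : 0 <= V by rewrite -lee_fin -QV.
(* At q = 1 the conjugate exponent is infinite, while [(1 - q^-1)^-1] would be the default 0; there
   both sides are the same integral. *)
have [<-|qn1] := eqVneq 1 q.
  rewrite Lnorm_onE ?oner_neq0// invr1 subrr powRr0 mule1 poweRe1.
    by under [leRHS]eq_integral do rewrite powRr1//.
  by apply: integral_ge0 => x _; rewrite lee_fin powR_ge0.
have qgt1 : 1 < q by rewrite lt_neqAle qn1.
pose r := (1 - q^-1)^-1.
have r0 : 0 < r by rewrite invr_gt0 subr_gt0 invf_lt1.
have mg' : measurable_fun setT (g \_ Q) by exact: measurable_patch.
have m1 : measurable_fun setT (\1_Q : T -> R) by exact: measurable_indic.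
have := hoelder mu mg' m1 q0 r0; rewrite invrK addrC subrK => /(_ erefl).
rewrite -Lnorm_on_restrict Lnorm1.
have -> : (\int[mu]_x `|(EFin \o (g \_ Q \* \1_Q)%R) x| =
    \int[mu]_(x in Q) `|g x|%:E)%E.
  rewrite [RHS]integral_mkcond; apply: eq_integral => x _.
  rewrite /= !patchE indicE; case: ifPn => xQ; first by rewrite mulr1.
  by rewrite mul0r normr0.
suff -> : Lnorm mu r%:E (EFin \o (\1_Q : T -> R)) = (V `^ (1 - q^-1))%:E by [].
rewrite unlock -[r^-1]/((1 - q^-1)^-1^-1) invrK -poweR_EFin; congr (_ `^ _)%E.
transitivity (\int[mu]_x (\1_Q x)%:E)%E; last by rewrite integral_indic// setIT.
apply: eq_integral => x _; rewrite /= indicE.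
by case: (x \in Q); rewrite ?normr1 ?powR1// normr0 powR0// gt_eqF.
Qed.

End Lnorm_on.

(** In the triangle inequality, 1 accounts for [g - m] and [cube_cst] for [m - PQ s Q g]. *)
Definition PQ_cst {R : realType} (n s : nat) : R := 1 + cube_cst n s.

(** * Near-optimality of P_Q(f) among polynomials in L^q *)

Section Lq.
Context {R : realType} {n : nat}.
Implicit Types (Q : set (Rn R n)) (g : Rn R n -> R) (q : R).

Lemma LqNorm_ge0 q Q g : (0 <= LqNorm q Q g)%E.
Proof. exact: Lnorm_ge0. Qed.

Lemma PQ_cst_gt0 s : 0 < PQ_cst n s :> R.
Proof.
by rewrite /PQ_cst ltr_pwDl// /cube_cst exprn_ge0// nikolskii_cst_ge0.
Qed.

(** Split g - P as (g - m) + (m - P). The second term is at most K U / |Q| pointwise, U being the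
    integral of |g - m|, so its norm is at most K U |Q|^(1/q - 1); Hölder bounds U by |Q|^(1 - 1/q)
    times the norm of g - m, and the powers of |Q| cancel. *)
Lemma LqNorm_PQ_le q s Q g m : 1 <= q -> is_cube Q ->
  leb.-integrable Q (EFin \o g) -> polys s m ->
  (LqNorm q Q (fun x => g x - peval (PQ s Q g) x)%R <=
   (PQ_cst n s)%:E * LqNorm q Q (fun x => g x - peval m x)%R)%E.
Proof.
move=> q1 cQ ig ms; have q0 : 0 < q by rewrite (lt_le_trans _ q1).
have mQ := measurable_cube cQ; have [V0 QV] := leb_cube cQ.
have mg : measurable_fun Q g by apply/measurable_EFinP; exact: measurable_int ig.
have mp h : measurable_fun Q (peval h).
  by apply: measurable_funTS; exact: measurable_peval.
pose u x := g x - peval m x; pose v x := peval m x - peval (PQ s Q g) x.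
have mu : measurable_fun Q u by exact: measurable_funB.
have mv : measurable_fun Q v by exact: measurable_funB.
have iu : leb.-integrable Q (EFin \o u) by exact: integrableB_peval.
have -> : (fun x => g x - peval (PQ s Q g) x) = (fun x => u x + v x).
  by apply/funext => x; rewrite /u /v addrA subrK.
apply: (le_trans (Lnorm_on_triangle leb q1 mQ mu mv)).
rewrite /PQ_cst EFinD ge0_muleDl ?lee_fin//; last first.
  by rewrite /cube_cst exprn_ge0// nikolskii_cst_ge0.
rewrite mul1e; apply: leeD => //.
set K := cube_cst n s; have K0 : 0 <= K by rewrite exprn_ge0// nikolskii_cst_ge0.
set U := fine (\int[leb]_(x in Q) `|u x|%:E)%E.
have UE : (\int[leb]_(x in Q) `|u x|%:E)%E = U%:E.
  by rewrite fineK//; apply: integrable_fin_num => //; exact: integrable_norm.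
have U0 : 0 <= U by apply: fine_ge0; apply: integral_ge0 => y _; rewrite lee_fin.
have vU x : Q x -> `|v x| <= K * U / vol Q.
  move=> Qx; rewrite ler_pdivlMr// /v distrC.
  exact: PQ_dist.
apply: (le_trans (Lnorm_on_bounded q1 mQ QV mv _ vU)).
  by rewrite divr_ge0 ?mulr_ge0// ltW.
rewrite -!mulrA EFinM; apply: lee_wpmul2l; first by rewrite lee_fin.
have : (U%:E <= LqNorm q Q u * (vol Q `^ (1 - q^-1))%:E)%E.
  by rewrite -UE; exact: (integral_le_Lnorm_on q1 mQ QV mu).
have E : (vol Q)^-1 * vol Q `^ q^-1 = (vol Q `^ (1 - q^-1))^-1.
  rewrite -powRN opprB powRD; last by rewrite (gt_eqF V0) implybT.
  by rewrite mulrC powR_inv1// ltW.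
by move=> HU; rewrite E EFinM [leLHS]muleC lee_pdivrMl ?powR_gt0// [leRHS]muleC.
Qed.

End Lq.

Lemma esum_le_scale (R : realType) (T : choiceType) (S : set T) (k : R)
    (a b : T -> \bar R) : 0 <= k -> (forall i, 0 <= b i)%E ->
  (forall i, S i -> a i <= k%:E * b i)%E ->
  (\esum_(i in S) a i <= k%:E * \esum_(i in S) b i)%E.
Proof.
move=> k0 b0 ab; apply: ge_ereal_sup => _ [X [finX XS]] <-.
apply: (@le_trans _ _ (k%:E * \sum_(i \in X) b i)%E).
  by rewrite ge0_mule_fsumr//; apply: lee_fsum => // i /XS; exact: ab.
apply: lee_wpmul2l; first by rewrite lee_fin.
by apply: ereal_sup_ubound; exists X.
Qed.

Lemma poweR_le_scale (R : realType) (k r : R) (x y : \bar R) :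
  0 <= r -> 0 <= k -> (0 <= x)%E -> (0 <= y)%E -> (x <= k%:E * y)%E ->
  (x `^ r <= (k `^ r)%:E * y `^ r)%E.
Proof.
move=> r0 k0 x0 y0 xy; rewrite -poweR_EFin -poweRM//.
by apply: gt0_ler_poweR => //; rewrite in_itv/= leey andbT// mule_ge0.
Qed.

(** * Comparison of the JN and V sums, norms and spaces *)

Section comparison.
Context {R : realType} {n : nat}.
Variables (p q : R) (s : nat) (alpha : R).
Hypothesis p_gt1 : 1 < p.
Hypothesis q_ge1 : 1 <= q.
Implicit Types (Q : set (Rn R n)) (f : Rn R n -> R) (F : set (set (Rn R n))).

Let p0 : 0 < p. Proof. exact: lt_trans p_gt1. Qed.
Let q0 : 0 < q. Proof. exact: lt_le_trans q_ge1. Qed.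
Let lambda := alpha + q^-1 - p^-1.

Local Notation osc Q f := (LqNorm q Q (fun x => f x - peval (PQ s Q f) x)%R).
Local Notation best Q f :=
  (ereal_inf [set LqNorm q Q (fun x => f x - peval m x)%R | m in polys s]).

(** Write |Q| as the p-th power of |Q|^(1/p) and move it inside: the exponents of |Q| add up to 1/p
    - alpha - 1/q, that is -lambda. *)
Lemma JN_termE Q f : is_cube Q ->
  ((vol Q)%:E * ((vol Q `^ (- alpha))%:E *
     ((vol Q)^-1%:E *
        \int[leb]_(x in Q) (`|f x - peval (PQ s Q f) x| `^ q)%:E) `^ q^-1)
     `^ p = ((vol Q `^ (- lambda))%:E * osc Q f) `^ p)%E.
Proof.
move=> cQ; have [V0 _] := leb_cube cQ; set v := vol Q.
have I0 : (0 <= \int[leb]_(x in Q) (`|f x - peval (PQ s Q f) x| `^ q)%:E)%E.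
  by apply: integral_ge0 => x _; rewrite lee_fin powR_ge0.
have oscE : osc Q f = ((\int[leb]_(x in Q)
    (`|f x - peval (PQ s Q f) x| `^ q)%:E) `^ q^-1)%E.
  by apply: Lnorm_onE; rewrite gt_eqF.
rewrite (@poweRM _ v^-1%:E _ q^-1) ?lee_fin ?invr_ge0 ?(ltW V0)//.
rewrite -oscE poweR_EFin muleA -EFinM.
have -> : v%:E = ((v `^ p^-1)%:E `^ p)%E.
  by rewrite poweR_EFin -powRrM mulVf ?gt_eqF// powRr1// ltW.
rewrite -poweRM ?lee_fin ?powR_ge0//; last first.
  by rewrite mule_ge0 ?LqNorm_ge0// lee_fin mulr_ge0 ?powR_ge0.
rewrite muleA -EFinM; congr ((_%:E * _) `^ p)%E.
rewrite -(@powR_inv1 _ v) ?(ltW V0)// -powRrM mulN1r.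
rewrite -!powRD ?(gt_eqF V0) ?implybT//.
by congr powR; rewrite /lambda; lra.
Qed.

Lemma polys0 : polys s (0 : mpoly n R).
Proof. by rewrite /polys/= msize0. Qed.

(** If no polynomial satisfies [is_PQ], then [PQ] is the default 0, which also lies in [polys s];
    thus [best_le_osc] covers every [f]. *)
Lemma polys_PQ Q f : polys s (PQ s Q f).
Proof. by rewrite /PQ; case: xgetP => [P _ []//|_]; exact: polys0. Qed.

Lemma best_ge0 Q f : (0 <= best Q f)%E.
Proof. by apply: le_ereal_inf_tmp => _ [m _ <-]; exact: LqNorm_ge0. Qed.

Lemma best_le_osc Q f : (best Q f <= osc Q f)%E.
Proof. by apply: ereal_inf_lbound; exists (PQ s Q f) => //; exact: polys_PQ. Qed.

Lemma osc_le_best Q f : is_cube Q -> leb.-integrable Q (EFin \o f) ->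
  (osc Q f <= (PQ_cst n s)%:E * best Q f)%E.
Proof.
move=> cQ ifQ; rewrite -lee_pdivrMl ?PQ_cst_gt0//.
apply: le_ereal_inf_tmp => _ [m ms <-].
by rewrite lee_pdivrMl ?PQ_cst_gt0//; exact: LqNorm_PQ_le.
Qed.

Lemma V_term_ge0 Q f : (0 <= (vol Q `^ (- lambda))%:E * best Q f)%E.
Proof. by rewrite mule_ge0 ?best_ge0// lee_fin powR_ge0. Qed.

Lemma V_sum_le f F : (forall Q, F Q -> is_cube Q) ->
  (V_sum p q lambda s f F <= JN_sum p q s alpha f F)%E.
Proof.
move=> cF; apply: le_esum => Q /cF cQ; rewrite JN_termE//.
have v0 : (0 <= (vol Q `^ (- lambda))%:E :> \bar R)%E by rewrite lee_fin powR_ge0.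
apply: gt0_ler_poweR; rewrite ?(ltW p0)// ?in_itv/= ?leey ?andbT ?V_term_ge0//.
  by rewrite mule_ge0 ?LqNorm_ge0.
by apply: lee_wpmul2l => //; exact: best_le_osc.
Qed.

Lemma JN_sum_le f F :
  (forall Q, F Q -> is_cube Q /\ leb.-integrable Q (EFin \o f)) ->
  (JN_sum p q s alpha f F <=
   (PQ_cst n s `^ p)%:E * V_sum p q lambda s f F)%E.
Proof.
move=> cF; apply: esum_le_scale => [|Q|Q /cF[cQ ifQ]].
- exact: powR_ge0.
- exact: poweR_ge0.
have v0 : (0 <= (vol Q `^ (- lambda))%:E :> \bar R)%E by rewrite lee_fin powR_ge0.
rewrite JN_termE//; apply: poweR_le_scale.
- exact: ltW.
- by rewrite ltW// PQ_cst_gt0.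
- by rewrite mule_ge0 ?LqNorm_ge0.
- exact: V_term_ge0.
by rewrite muleCA; apply: lee_wpmul2l => //; exact: osc_le_best.
Qed.

Lemma V_norm_le f : (V_norm p q lambda s f <= JN_norm p q s alpha f)%E.
Proof.
apply: ge_ereal_sup => _ [F FF <-].
apply: (@le_trans _ _ (JN_sum p q s alpha f F `^ p^-1)%E); last first.
  by apply: ereal_sup_ubound; exists F.
have V0 : (0 <= V_sum p q lambda s f F)%E.
  by apply: esum_ge0 => Q _; exact: poweR_ge0.
have VJ := V_sum_le f (fun Q FQ => (FF.1 Q FQ).1).
apply: gt0_ler_poweR; rewrite ?invr_ge0 ?(ltW p0)// ?in_itv/= ?leey ?andbT//.
exact: le_trans VJ.
Qed.

Lemma cube_unit_cube : is_cube (@unit_cube R n).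
Proof.
exists (fun=> 0), 1, (fun=> true), (fun=> false); split=> //.
by apply/seteqP; split=> x H i; have := H i; rewrite in_itv/= add0r.
Qed.

Lemma JN_norm_le f : leb.-integrable unit_cube (EFin \o f) ->
  (JN_norm p q s alpha f <= (PQ_cst n s)%:E * V_norm p q lambda s f)%E.
Proof.
move=> intf; apply: ge_ereal_sup => _ [F FF <-].
have V0 : (0 <= V_sum p q lambda s f F)%E.
  by apply: esum_ge0 => Q _; exact: poweR_ge0.
have J0 : (0 <= JN_sum p q s alpha f F)%E.
  apply: esum_ge0 => Q FQ; rewrite JN_termE ?poweR_ge0//.
  exact: (FF.1 Q FQ).1.
apply: (@le_trans _ _
    ((PQ_cst n s)%:E * V_sum p q lambda s f F `^ p^-1)%E); last first.
  apply: lee_wpmul2l; first by rewrite lee_fin ltW// PQ_cst_gt0.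
  by apply: ereal_sup_ubound; exists F.
have -> : PQ_cst n s = (PQ_cst n s `^ p) `^ p^-1 :> R.
  by rewrite -powRrM mulfV ?gt_eqF// powRr1// ltW// PQ_cst_gt0.
apply: poweR_le_scale => //.
- by rewrite invr_ge0 ltW.
- exact: powR_ge0.
apply: JN_sum_le => Q FQ; have [cQ QU] := FF.1 Q FQ; split=> //.
(* Integrability passes from the unit cube to each [Q] of the family, so that [osc_le_best] applies
   on it. *)
apply: (integrableS _ _ QU intf); apply: measurable_cube => //.
exact: cube_unit_cube.
Qed.

(** By Hölder, as a cube has finite measure; supplies the L^1 membership in [JN_space]. *)
Lemma LqNorm_integrable Q f : is_cube Q -> measurable_fun Q f ->
  (LqNorm q Q f < +oo)%E -> leb.-integrable Q (EFin \o f).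
Proof.
move=> cQ mf foo; have [V0 QV] := leb_cube cQ; have mQ := measurable_cube cQ.
apply/integrableP; split; first exact/measurable_EFinP.
apply: (le_lt_trans (integral_le_Lnorm_on q_ge1 mQ QV mf)).
by rewrite muleC lte_mul_pinfty ?lee_fin ?powR_ge0.
Qed.

(** The family consisting of the unit cube alone shows that f - P is in L^q there, and the
    polynomial P is bounded on it. Supplies the L^q membership in [V_space]. *)
Lemma JN_norm_LqNorm f : leb.-integrable unit_cube (EFin \o f) ->
  (JN_norm p q s alpha f < +oo)%E -> (LqNorm q unit_cube f < +oo)%E.
Proof.
move=> intf foo; have cU := cube_unit_cube.
have [V0 QV] := leb_cube cU; have mQ := measurable_cube cU.
set P := PQ s unit_cube f.
have oscoo : (osc unit_cube f < +oo)%E.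
  have : (JN_sum p q s alpha f [set unit_cube] `^ p^-1 < +oo)%E.
    apply: le_lt_trans foo; apply: ereal_sup_ubound.
    exists [set unit_cube] => //; split=> [Q ->|]; first by split.
    by move=> Q Q' -> ->.
  move=> /lty_poweRy; rewrite invr_eq0 gt_eqF// => /(_ isT).
  rewrite /JN_sum esum_set1 JN_termE ?poweR_ge0//.
  move=> /lty_poweRy; rewrite gt_eqF// => /(_ isT).
  (* An infinite oscillation would stay infinite after multiplication by a positive power of the
     volume. *)
  apply: contraTT; rewrite -!leNgt !leye_eq => /eqP ->.
  by rewrite gt0_muley// lte_fin powR_gt0.
have mf : measurable_fun unit_cube f.
  by apply/measurable_EFinP; exact: measurable_int intf.
have mP : measurable_fun unit_cube (peval P : Rn R n -> R).
  by apply: measurable_funTS; exact: measurable_peval.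
have [M M0 PM] := bounded_peval cU P.
have -> : f = (fun x => (f x - peval P x) + peval P x).
  by apply/funext => x; rewrite subrK.
have := Lnorm_on_triangle leb q_ge1 mQ (measurable_funB mf mP) mP.
move=> /le_lt_trans; apply; apply: lte_add_pinfty; first exact: oscoo.
apply: (le_lt_trans (Lnorm_on_bounded q_ge1 mQ QV mP M0 PM)).
exact: ltry.
Qed.

End comparison.

Theorem proposition1p25 (R : realType) (n : nat) (p q : R) (s : nat) (alpha : R)
    (n_gt0 : (0 < n)%N) (p_gt1 : 1 < p) (q_ge1 : 1 <= q)
    (alpha_ge0 : 0 <= alpha) (alpha_le : alpha <= s.+1%:R / n%:R) :
  V_space n p q (alpha + q^-1 - p^-1) s = JN_space n p q s alpha /\
  exists c C : R, 0 < c /\ 0 < C /\ forall f : Rn R n -> R, JN_space n p q s alpha f ->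
    (c%:E * JN_norm p q s alpha f <= V_norm p q (alpha + q^-1 - p^-1) s f /\
     V_norm p q (alpha + q^-1 - p^-1) s f <= C%:E * JN_norm p q s alpha f)%E.
Proof.
have K0 : 0 < PQ_cst n s :> R by exact: PQ_cst_gt0.
split.
  apply/seteqP; split=> f.
    move=> [mf [Lf Vf]].
    have intf := LqNorm_integrable q_ge1 cube_unit_cube mf Lf; split=> //.
    apply: (le_lt_trans (JN_norm_le s alpha p_gt1 q_ge1 intf)).
    by rewrite lte_mul_pinfty// lee_fin ltW.
  move=> [intf Jf]; split.
    by apply/measurable_EFinP; exact: measurable_int intf.
  split; first exact: (JN_norm_LqNorm p_gt1 q_ge1 intf Jf).
  exact: (le_lt_trans (V_norm_le s alpha p_gt1 q_ge1 f) Jf).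
(* The V norm is at most the JN norm outright; only the reverse bound loses [PQ_cst n s]. *)
exists (PQ_cst n s)^-1, 1; split; first by rewrite invr_gt0.
split=> // f [intf _]; split; last by rewrite mul1e; exact: V_norm_le.
by rewrite lee_pdivrMl//; exact: JN_norm_le.
Qed.
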